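(* Let $\mathcal{P}$ be a PTRS containing a rule $\ell\to\{p_1:C[\ell\sigma],\,p_2:s,\,\dots\}$, i.e., a rule whose right-hand side multi-distribution contains (as two of its entries) a term of the form $C[\ell\sigma]$ for some context $C$ and substitution $\sigma$, and a term $s$, such that there is a variable $x\in\mathcal{V}(\ell)$ with $x\in\mathcal{V}(x\sigma)\cap\mathcal{V}(s)$. Then $\mathtt{PAST}(\xrightarrow{\mathbf{f}}_{\mathcal{P}})$ holds if and only if $\mathtt{SAST}(\xrightarrow{\mathbf{f}}_{\mathcal{P}})$ holds.
   Context: Terms $\mathcal{T}$ over countable signature and variables; a context is a term with one hole. $\mathrm{FDist}(A)$: finite multisets of pairs $(p:a)$, $0<p\le1$, probabilities summing to 1. A PTRS is a countable set $\mathcal{P}$ of rules $\ell\to\mu$, $\ell$ non-variable, $\mu\in\mathrm{FDist}(\mathcal{T})$, variables of terms in $\mu$ among those of $\ell$. $t\xrightarrow{\mathbf{f}}_{\mathcal{P}}\{p_1:t_1,\dots,p_k:t_k\}$ iff $t|_\pi=\ell\sigma$, $t_j=t[r_j\sigma]_\pi$ for a position $\pi$, rule $\ell\to\{p_1:r_1,\dots,p_k:r_k\}$, substitution $\sigma$; normal forms admit no step. Lifting $\rightrightarrows$: smallest relation on multi-distributions with $\{1:t\}\rightrightarrows\{1:t\}$ for normal forms, $\{1:t\}\rightrightarrows\mu$ if $t\xrightarrow{\mathbf{f}}_{\mathcal{P}}\mu$, closed under $\bigcup_jp_j\cdot\mu_j\rightrightarrows\bigcup_jp_j\cdot\nu_j$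 ($\sum p_j=1$). $|\mu|$: probability of normal forms; $\mathrm{edl}((\mu_n))=\sum_n(1-|\mu_n|)$. $\mathtt{PAST}$: every infinite $\rightrightarrows$-sequence with $\mu_0=\{1:t\}$ has finite $\mathrm{edl}$. $\mathtt{SAST}$: for every term $t$, the supremum of $\mathrm{edl}$ over infinite $\rightrightarrows$-sequences with $\mu_0=\{1:t\}$ is finite. *)

(* Defs.v *)
From HB Require Import structures.
From mathcomp Require Import all_boot all_order all_algebra.
From mathcomp Require Import finmap multiset.
From mathcomp Require Import all_classical all_reals all_analysis.

Set Implicit Arguments.
Unset Strict Implicit.
Unset Printing Implicit Defensive.

Import Order.TTheory GRing.Theory Num.Theory.

Local Open Scope classical_set_scope.
Local Open Scope ring_scope.

Section Terms.
Context {F : countType} {ar : F -> nat} {V : countType}.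

Inductive term : Type :=
| Var of V
| App (f : F) of ('I_(ar f) -> term).

HB.instance Definition _ := gen_eqMixin term.
HB.instance Definition _ := gen_choiceMixin term.

Definition is_var (t : term) : Prop := exists x, t = Var x.

Fixpoint vars (t : term) : set V :=
  match t with
  | Var y => [set y]
  | App f args => \bigcup_i vars (args i)
  end.

Definition substitution := V -> term.

Fixpoint subst (sigma : substitution) (t : term) : term :=
  match t with
  | Var y => sigma y
  | App f args => App (fun i => subst sigma (args i))
  end.

(* Positions are sequences of argument indices, counted from 0. *)
Definition position := seq nat.

Fixpoint subterm_at (t : term) (pi : position) {struct pi} : option term :=
  match pi with
  | [::] => Some t
  | i :: pi' =>
      match t with
      | Var _ => None
      | App f args =>
          if @insub nat (fun k => k < ar f)%N 'I_(ar f) i is Some j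
          then subterm_at (args j) pi' else None
      end
  end.

(* Equals t itself when pi is not a position of t; it is only used under the
   assumption that subterm_at t pi is defined. *)
Fixpoint replace_at (t : term) (pi : position) (u : term) {struct pi} : term :=
  match pi with
  | [::] => u
  | i :: pi' =>
      match t with
      | Var _ => t
      | App f args =>
          App (fun j : 'I_(ar f) =>
                 if nat_of_ord j == i then replace_at (args j) pi' u
                 else args j)
      end
  end.

(* In CApp i args C, the i-th argument is the context C, and the other ones
   are given by args; the value args i is irrelevant. *)
Inductive context : Type :=
| Hole
| CApp (f : F) (i : 'I_(ar f)) (args : 'I_(ar f) -> term) of context.

Fixpoint fill (C : context) (u : term) : term :=
  match C with
  | Hole => u
  | CApp f i args C' =>
      App (fun j : 'I_(ar f) => if j == i then fill C' u else args j)
  end.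

End Terms.

Arguments term {F} ar V.
Arguments substitution {F} ar V.
Arguments context {F} ar V.

(* Finite multisets of pairs (p : a). A priori the weights are arbitrary;
   FDist(A) is cut out by is_fdist, and lifting_fdist with rewrite_step_fdist
   shows that the lifting only relates elements of FDist(A). *)
Notation multidist R A := {mset R * A}%mset.

Section MultiDistributions.
Context {R : realType} {A : choiceType}.

Definition is_fdist (mu : multidist R A) : Prop :=
  (forall e : R * A, e \in mu -> 0 < e.1 <= 1) /\ \sum_(e <- mu) e.1 = 1.

Definition dirac_fdist (a : A) : multidist R A := [mset (1, a)]%mset.

Definition scale_mset (p : R) (mu : multidist R A) : multidist R A :=
  seq_mset [seq (p * e.1, e.2) | e <- mu].

Definition convex_union (n : nat) (p : 'I_n -> R) (mu : 'I_n -> multidist R A) :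
    multidist R A :=
  \big[msetD/mset0]_(j < n) scale_mset (p j) (mu j).

Lemma is_fdist_dirac (a : A) : is_fdist (dirac_fdist a).
Proof.
split=> [e|]; last by rewrite enum_msetn big_seq1.
by rewrite in_mset1 => /eqP -> /=; rewrite ltr01 lexx.
Qed.

Lemma is_fdist_convex_union (n : nat) (p : 'I_n -> R) (mu : 'I_n -> multidist R A) :
  (forall j, 0 < p j <= 1) -> \sum_(j < n) p j = 1 ->
  (forall j, is_fdist (mu j)) -> is_fdist (convex_union p mu).
Proof.
move=> p01 p1 mufd; split.
- rewrite /convex_union; elim/big_ind: _ => [e|M N IM IN e|j _ e].
  + by rewrite in_mset0.
  + by rewrite in_msetD => /orP[/IM|/IN].
  + rewrite (perm_mem (perm_eq_seq_mset _)) => /mapP[e' /(proj1 (mufd j))].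
    move=> /andP[e0 e1] -> /=; have /andP[q0 q1] := p01 j.
    by rewrite mulr_gt0 //= mulr_ile1 // ltW.
- rewrite -p1 /convex_union.
  have sumD (M N : multidist R A) : \sum_(e <- (M `+` N)%mset) e.1 =
      \sum_(e <- M) e.1 + \sum_(e <- N) e.1.
    have h : perm_eq (M `+` N)%mset (M ++ N).
      by apply/allP => e _ /=; rewrite count_cat !count_mem_mset msetE2.
    by rewrite (perm_big _ h) big_cat.
  rewrite (big_morph (fun M : multidist R A => \sum_(e <- M) e.1) sumD (id1 := 0));
    last by rewrite enum_mset0 big_nil.
  apply: eq_bigr => j _; rewrite (perm_big _ (perm_eq_seq_mset _)) big_map.
  by rewrite -mulr_sumr (proj2 (mufd j)) mulr1.
Qed.

End MultiDistributions.

Definition map_fdist (R : realType) (A B : choiceType) (g : A -> B)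
    (mu : multidist R A) : multidist R B :=
  seq_mset [seq (e.1, g e.2) | e <- mu].

Section Lifting.
Context {R : realType} {A : choiceType}.
Variable step : A -> multidist R A -> Prop.

Definition normal_form (a : A) : Prop := ~ exists mu, step a mu.

Inductive lifting : multidist R A -> multidist R A -> Prop :=
| lifting_nf a : normal_form a -> lifting (dirac_fdist a) (dirac_fdist a)
| lifting_step a mu : step a mu -> lifting (dirac_fdist a) mu
| lifting_union n (p : 'I_n -> R) (mu nu : 'I_n -> multidist R A) :
    (forall j, 0 < p j <= 1) -> \sum_(j < n) p j = 1 ->
    (forall j, lifting (mu j) (nu j)) ->
    lifting (convex_union p mu) (convex_union p nu).

Lemma lifting_fdist mu nu :
  (forall a rho, step a rho -> is_fdist rho) ->
  lifting mu nu -> is_fdist mu /\ is_fdist nu.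
Proof.
move=> stepP; elim=> {mu nu} [a _|a mu /stepP fmu|n p mu nu p01 p1 _ IH].
- by split; apply: is_fdist_dirac.
- by split; first exact: is_fdist_dirac.
- by split; apply: is_fdist_convex_union => // j; have [] := IH j.
Qed.

Definition nf_prob (mu : multidist R A) : R :=
  \sum_(e <- mu | `[< normal_form e.2 >]) e.1.

Definition edl (mu : nat -> multidist R A) : \bar R :=
  (\sum_(0 <= n <oo) (1 - nf_prob (mu n))%:E)%E.

Definition lifting_seqs (a : A) : set (nat -> multidist R A) :=
  [set mu | mu 0%N = dirac_fdist a /\ forall n, lifting (mu n) (mu n.+1)].

Definition PAST : Prop :=
  forall (a : A) mu, lifting_seqs a mu -> (edl mu < +oo)%E.

Definition SAST : Prop :=
  forall a : A, (ereal_sup [set edl mu | mu in lifting_seqs a] < +oo)%E.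

End Lifting.

Section PTRS.
Context {R : realType} {F : countType} {ar : F -> nat} {V : countType}.
Local Notation T := (term ar V).

Definition is_ptrs (P : set (T * multidist R T)) : Prop :=
  countable P /\
  forall l mu, P (l, mu) ->
    [/\ ~ is_var l, is_fdist mu &
        forall e, e \in mu -> vars e.2 `<=` vars l].

Definition rewrite_step (P : set (T * multidist R T)) (t : T)
    (nu : multidist R T) : Prop :=
  exists (pi : position) l mu (sigma : substitution ar V),
    [/\ P (l, mu), subterm_at t pi = Some (subst sigma l) &
        nu = map_fdist (fun r => replace_at t pi (subst sigma r)) mu].

Lemma rewrite_step_fdist (P : set (T * multidist R T)) t nu :
  is_ptrs P -> rewrite_step P t nu -> is_fdist nu.
Proof.
move=> [_ PP] [pi [l [mu [sigma [/PP[_ [mu01 mu1] _] _ ->]]]]]; split=> [e|].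
  by rewrite (perm_mem (perm_eq_seq_mset _)) => /mapP[e' /mu01 ? ->].
by rewrite (perm_big _ (perm_eq_seq_mset _)) big_map.
Qed.

End PTRS.

(* Main.v *)
(** If [SAST] fails at a term [t], then for every [r] some strategy makes more
    than [r] expected steps from [t].  Start the looping rule at the instance of
    [l] sending all variables to [t].  After [k] rounds of the loop, which happen
    with probability [p1 ^+ k], the branch [s] is taken with probability [p2],
    and it leads to a term that still contains [t], because [x] survives in both
    [sigma x] and [s].  There continue with a strategy making at least
    [1 / (p1 ^+ k * p2)] expected steps: every [k] then contributes at least [1]
    to the expected derivation length, which is infinite, so [PAST] fails.

    Strategies are handled through the optimal expected number of steps within a
    finite horizon, which does not decrease when a term is put in a context: this
    takes care of normal forms that become reducible in a context. *)

Require Import Defs.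
From mathcomp Require Import all_boot all_order all_algebra.
From mathcomp Require Import finmap multiset.
From mathcomp Require Import all_classical all_reals all_analysis.
From mathcomp Require Import lra.

Set Implicit Arguments.
Unset Strict Implicit.
Unset Printing Implicit Defensive.

Import Order.TTheory GRing.Theory Num.Theory.

Local Open Scope classical_set_scope.
Local Open Scope ring_scope.

(** * Expectation of a real function under a multi-distribution *)

Section Expectation.
Context {R : realType} {A : choiceType}.
Implicit Types (f g : A -> R) (mu nu : multidist R A) (s : seq (R * A)).

Definition expect f mu : R := \sum_(e <- mu) e.1 * f e.2.

Lemma expect_seq_mset f s : expect f (seq_mset s) = \sum_(e <- s) e.1 * f e.2.
Proof. exact: perm_big (perm_eq_seq_mset s). Qed.

Lemma expect_dirac f a : expect f (dirac_fdist a) = f a.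
Proof. by rewrite /expect enum_msetn big_seq1 mul1r. Qed.

Lemma expectD f mu nu :
  expect f (mu `+` nu)%mset = expect f mu + expect f nu.
Proof.
have h : perm_eq (mu `+` nu)%mset (mu ++ nu).
  by apply/allP => e _ /=; rewrite count_cat !count_mem_mset msetE2.
by rewrite /expect (perm_big _ h) big_cat.
Qed.

Lemma expect_convex_union f n (p : 'I_n -> R) (mu : 'I_n -> multidist R A) :
  expect f (convex_union p mu) = \sum_(j < n) p j * expect f (mu j).
Proof.
rewrite /convex_union (big_morph _ (expectD f) (id1 := 0)); last first.
  by rewrite /expect enum_mset0 big_nil.
apply: eq_bigr => j _; rewrite expect_seq_mset big_map /= mulr_sumr.
by apply: eq_bigr => e _; rewrite mulrA.
Qed.

Lemma le_expect f g mu :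
  is_fdist mu -> (forall a, f a <= g a) -> expect f mu <= expect g mu.
Proof.
move=> [mu01 _] fg; rewrite /expect big_seq [leRHS]big_seq.
apply: ler_sum => e /mu01 /andP[e0 _].
by rewrite ler_pM2l.
Qed.

Lemma expect_cst c mu : is_fdist mu -> expect (fun=> c) mu = c.
Proof. by move=> [_ mu1]; rewrite /expect -mulr_suml mu1 mul1r. Qed.

Lemma is_fdist_seq_mset s : is_fdist (seq_mset s) ->
  (forall i, 0 < (tnth (in_tuple s) i).1 <= 1) /\
  \sum_(i < size s) (tnth (in_tuple s) i).1 = 1.
Proof.
move=> [s01 s1]; split=> [i|].
  by apply: s01; rewrite (perm_mem (perm_eq_seq_mset _)) mem_tnth.
by rewrite -s1 (perm_big _ (perm_eq_seq_mset _)) [RHS]big_tnth.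
Qed.

End Expectation.

(** * Images of distributions and decomposition into Dirac distributions *)

Section MapFdist.
Context {R : realType}.

Lemma expect_map_fdist (A B : choiceType) (f : B -> R) (g : A -> B)
  (mu : multidist R A) : expect f (map_fdist g mu) = expect (f \o g) mu.
Proof. by rewrite expect_seq_mset big_map. Qed.

Lemma map_fdist_comp (A B C : choiceType) (g : B -> C) (h : A -> B)
    (mu : multidist R A) :
  map_fdist g (map_fdist h mu) = map_fdist (g \o h) mu.
Proof.
apply/eq_seq_msetP; rewrite /map_fdist.
rewrite (perm_trans (perm_map _ (perm_eq_seq_mset _))) //.
by rewrite -map_comp; exact: perm_refl.
Qed.

Lemma map_fdist_seq_mset (A B : choiceType) (g : A -> B) (s : seq (R * A)) :
  map_fdist g (seq_mset s) = seq_mset [seq (e.1, g e.2) | e <- s].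
Proof. exact/eq_seq_msetP/perm_map/perm_eq_seq_mset. Qed.

Lemma convex_union_dirac (A B : choiceType) (g : A -> B) (s : seq (R * A)) :
  convex_union (fun i => (tnth (in_tuple s) i).1)
    (fun i => dirac_fdist (g (tnth (in_tuple s) i).2)) =
  map_fdist g (seq_mset s).
Proof.
have scale_dirac p (b : B) :
    scale_mset p (dirac_fdist b) = [mset (p, b)]%mset :> multidist R B.
  by rewrite -[RHS]seq_mset_id /scale_mset !enum_msetn /= mulr1.
rewrite map_fdist_seq_mset /convex_union.
under eq_bigr do rewrite scale_dirac.
rewrite -(big_tnth _ _ s predT (fun e : R * A => [mset (e.1, g e.2)]%mset)).
elim: s => [|e s IH]; first by rewrite big_nil -[LHS]seq_mset_id enum_mset0.
by rewrite big_cons IH /= mset_cons.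
Qed.

(** In this shape [lifting_union] can act on an arbitrary distribution, one entry at a time. *)
Lemma seq_mset_convex_union (A : choiceType) (s : seq (R * A)) :
  seq_mset s = convex_union (fun i => (tnth (in_tuple s) i).1)
    (fun i => dirac_fdist (tnth (in_tuple s) i).2).
Proof.
rewrite (convex_union_dirac id) map_fdist_seq_mset; congr seq_mset.
by rewrite -[LHS]map_id; apply: eq_map => -[].
Qed.

End MapFdist.

(** * The finite-horizon value and its relation to [edl] *)

Section Value.
Context {R : realType} {A : choiceType} (step : A -> multidist R A -> Prop).
Context (step_fdist : forall a nu, step a nu -> is_fdist nu).
Implicit Types (a b : A) (mu nu : multidist R A) (S : nat -> multidist R A).

Definition reducible a : R := (~~ `[< normal_form step a >])%:R.

Definition work N S : R := \sum_(n < N) expect reducible (S n).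

(* The optimal expected number of steps within horizon [N]; at normal forms the
   supremum is over the empty set, hence [0]. *)
Fixpoint value N a : R :=
  if N is N'.+1 then sup [set 1 + expect (value N') nu | nu in step a] else 0.

Lemma expect_reducible_ge0 mu : is_fdist mu -> 0 <= expect reducible mu.
Proof.
by move=> fmu; rewrite -(expect_cst 0 fmu); apply: le_expect => // a.
Qed.

Lemma reducible_nf a : normal_form step a -> reducible a = 0.
Proof. by move=> nfa; rewrite /reducible asboolT. Qed.

Lemma reducible_step a nu : step a nu -> reducible a = 1.
Proof.
move=> anu; rewrite /reducible asboolF //.
by apply; exists nu.
Qed.

Lemma nf_probE mu : is_fdist mu -> 1 - nf_prob step mu = expect reducible mu.
Proof.
move=> [_ mu1]; rewrite /nf_prob /expect -mu1.
rewrite (bigID (fun e : R * A => `[< normal_form step e.2 >])) /= addrC addrK.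
rewrite big_mkcond /=; apply: eq_bigr => e _; rewrite /reducible.
by case: asbool; rewrite /= ?mulr0 ?mulr1.
Qed.

Lemma value_nf N a : normal_form step a -> value N a = 0.
Proof.
case: N => //= N nfa; rewrite (_ : [set _ | _ in _] = set0) ?sup0 //.
by apply/seteqP; split=> // y [nu anu _]; apply: nfa; exists nu.
Qed.

(** The upper bound also keeps the set under [sup] bounded; otherwise [sup] would take a default
    value. *)
Lemma value_bounds N a : 0 <= value N a <= N%:R.
Proof.
elim: N a => [|N IH] a; first by rewrite /= lexx.
case: (pselect (normal_form step a)) => [nfa|/contrapT[nu0 anu0]].
  by rewrite value_nf // lexx ler0n.
have ub : ubound [set 1 + expect (value N) nu | nu in step a] N.+1%:R.
  move=> y [nu /step_fdist fnu <-]; rewrite -natr1 addrC lerD2r.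
  rewrite -(expect_cst N%:R fnu).
  by apply: le_expect => // b; have /andP[] := IH b.
apply/andP; split; last first.
  by apply: ge_sup => //; exists (1 + expect (value N) nu0), nu0.
apply: (@le_trans _ _ (1 + expect (value N) nu0)).
  rewrite addr_ge0 // -(expect_cst 0 (step_fdist anu0)).
  by apply: le_expect; [exact: step_fdist anu0|move=> b; have /andP[] := IH b].
by apply: ub_le_sup; [exists N.+1%:R|exists nu0].
Qed.

Lemma value_ge0 N a : 0 <= value N a.
Proof. by have /andP[] := value_bounds N a. Qed.

Lemma has_sup_value N a nu : step a nu ->
  has_sup [set 1 + expect (value N) nu | nu in step a].
Proof.
move=> anu; split; first by exists (1 + expect (value N) nu), nu.
exists (1 + N%:R) => y [rho /step_fdist frho <-]; rewrite lerD2l.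
rewrite -(expect_cst N%:R frho).
by apply: le_expect => // b; have /andP[] := value_bounds N b.
Qed.

Lemma value_step N a nu : step a nu -> 1 + expect (value N) nu <= value N.+1 a.
Proof.
by move=> anu; apply: sup_upper_bound; [exact: has_sup_value anu|exists nu].
Qed.

(** One step of the Bellman inequality. Both sides are linear under convex unions, so only Dirac
    distributions need an argument. *)
Lemma lifting_value N mu nu : lifting step mu nu ->
  expect reducible mu + expect (value N) nu <= expect (value N.+1) mu.
Proof.
elim=> {mu nu} [a nfa|a nu anu|n p mu nu p01 p1 _ IH].
- by rewrite !expect_dirac reducible_nf // !value_nf // addr0.
- by rewrite !expect_dirac (reducible_step anu) value_step.
- rewrite !expect_convex_union -big_split /=; apply: ler_sum => j _.
  by rewrite -mulrDr ler_wpM2l //; case/andP: (p01 j) => /ltW.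
Qed.

Lemma work_le_value N S : (forall n, lifting step (S n) (S n.+1)) ->
  work N S <= expect (value N) (S 0%N).
Proof.
elim: N S => [|N IH] S liftS.
  by rewrite /work big_ord0 /expect big1 // => e _; rewrite mulr0.
rewrite /work big_ord_recl; apply: le_trans (lifting_value N (liftS 0%N)).
by rewrite lerD2l; apply: (IH (fun n => S n.+1)) => n; exact: liftS.
Qed.

Lemma lifting_total mu : is_fdist mu -> exists nu, lifting step mu nu.
Proof.
rewrite -(seq_mset_id mu); move: (enum_mset mu) => s fs.
have [p01 p1] := is_fdist_seq_mset fs.
have dirac_total a : exists nu, lifting step (dirac_fdist a) nu.
  case: (pselect (normal_form step a)) => [nfa|/contrapT[nu anu]].
    by exists (dirac_fdist a); exact: lifting_nf.
  by exists nu; exact: lifting_step.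
rewrite seq_mset_convex_union; eexists; apply: lifting_union => // i.
exact: projT2 (cid (dirac_total (tnth (in_tuple s) i).2)).
Qed.

Lemma lifting_seq_fdist a S : lifting_seqs step a S -> forall n, is_fdist (S n).
Proof.
by move=> [_ liftS] n; have [] := lifting_fdist step_fdist (liftS n).
Qed.

Lemma lifting_seqs_nonempty a : exists S, lifting_seqs step a S.
Proof.
(* Outside distributions the choice is arbitrary; such a case is never reached from a Dirac
   distribution. *)
have next mu : {nu | is_fdist mu -> lifting step mu nu}.
  apply: cid; case: (pselect (is_fdist mu)) => [/lifting_total[nu]|].
    by exists nu.
  by exists mu.
pose S n := iter n (fun mu => projT1 (next mu)) (dirac_fdist a).
exists S; split=> // n.
suff fS : is_fdist (S n) by exact: projT2 (next (S n)) fS.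
elim: n => [|n IH]; first exact: is_fdist_dirac.
by have [] := lifting_fdist step_fdist (projT2 (next (S n)) IH).
Qed.

Lemma work_ge0 N a S : lifting_seqs step a S -> 0 <= work N S.
Proof.
move=> /lifting_seq_fdist fS; apply: sumr_ge0 => n _.
exact: expect_reducible_ge0.
Qed.

Lemma leq_work M N a S : (M <= N)%N -> lifting_seqs step a S ->
  work M S <= work N S.
Proof.
move=> leMN /lifting_seq_fdist fS.
rewrite /work -!(big_mkord xpredT (fun n => expect reducible (S n))).
rewrite [leRHS](big_cat_nat (n := M)) //= lerDl sumr_ge0 // => n _.
exact: expect_reducible_ge0.
Qed.

Lemma work_le_edl N a S : lifting_seqs step a S ->
  ((work N S)%:E <= edl step S)%E.
Proof.
move=> seqS; have fS := lifting_seq_fdist seqS.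
rewrite /edl; under eq_eseriesr do rewrite nf_probE //.
rewrite (_ : (work N S)%:E = \sum_(0 <= n < N) (expect reducible (S n))%:E)%E.
  apply: nneseries_lim_ge => n _ _; rewrite lee_fin.
  exact: expect_reducible_ge0.
by rewrite big_mkord sumEFin.
Qed.

Lemma edl_le (r : R) a S : lifting_seqs step a S ->
  (forall N, work N S <= r) -> (edl step S <= r%:E)%E.
Proof.
move=> seqS leS; have fS := lifting_seq_fdist seqS.
rewrite /edl; under eq_eseriesr do rewrite nf_probE //.
apply: lime_le.
  apply: is_cvg_nneseries => n _ _; rewrite lee_fin.
  exact: expect_reducible_ge0.
by apply: nearW => N; rewrite big_mkord sumEFin lee_fin; exact: leS.
Qed.

(** Half of [eps] pays for a first step that nearly attains the supremum, the other half for the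
    continuations from its outcomes, whose losses are averaged with weights summing to 1. *)
Lemma near_optimal_seq N a (eps : R) : 0 < eps ->
  exists2 S, lifting_seqs step a S & value N a - eps <= work N S.
Proof.
move=> eps0; elim: N a eps eps0 => [|N IH] a eps eps0.
  have [S seqS] := lifting_seqs_nonempty a.
  by exists S => //; rewrite /work big_ord0 /= sub0r oppr_le0 ltW.
case: (pselect (normal_form step a)) => [nfa|/contrapT[nu0 anu0]].
  have [S seqS] := lifting_seqs_nonempty a; exists S => //.
  by rewrite value_nf // (le_trans _ (work_ge0 _ seqS)) // sub0r oppr_le0 ltW.
have eps2 : 0 < eps / 2 by rewrite divr_gt0.
have [y [nu anu <-] ltnu] := sup_adherent eps2 (has_sup_value N anu0).
have fnu := step_fdist anu.
rewrite -[nu]seq_mset_id in anu ltnu fnu.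
move: (enum_mset nu) => s in anu ltnu fnu.
have [p01 p1] := is_fdist_seq_mset fnu.
have /choice[T TP] : forall b, exists S, lifting_seqs step b S /\
    value N b - eps / 2 <= work N S.
  by move=> b; have [S ? ?] := IH b _ eps2; exists S.
(* All continuations start from Dirac distributions, so the union of their starts is the
   distribution reached by the chosen step. *)
have nuE : seq_mset s = convex_union (fun i => (tnth (in_tuple s) i).1)
    (fun i => T (tnth (in_tuple s) i).2 0%N).
  rewrite seq_mset_convex_union.
  congr (convex_union _ _); apply: funext => i.
  by have [[->]] := TP (tnth (in_tuple s) i).2.
pose S n := if n is n'.+1 then convex_union (fun i => (tnth (in_tuple s) i).1)
    (fun i => T (tnth (in_tuple s) i).2 n') else dirac_fdist a.
exists S.
  split=> // -[|n] /=; first by rewrite -nuE; exact: lifting_step.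
  by apply: lifting_union => // i; have [[_]] := TP (tnth (in_tuple s) i).2.
rewrite /work big_ord_recl /= expect_dirac (reducible_step anu).
have -> : \sum_(i < N) expect reducible (S (lift ord0 i)) =
    \sum_(i < size s) (tnth (in_tuple s) i).1 *
      work N (T (tnth (in_tuple s) i).2).
  under eq_bigr do rewrite /= expect_convex_union.
  by rewrite exchange_big; apply: eq_bigr => i _; rewrite mulr_sumr.
have : expect (value N) (seq_mset s) - eps / 2 <=
    \sum_(i < size s) (tnth (in_tuple s) i).1 *
      work N (T (tnth (in_tuple s) i).2).
  rewrite expect_seq_mset big_tnth -[eps / 2]mul1r -[X in X * _]p1.
  rewrite mulr_suml -sumrB.
  apply: ler_sum => i _; rewrite -mulrBr ler_wpM2l //.
    by case/andP: (p01 i) => /ltW.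
  by have [] := TP (tnth (in_tuple s) i).2.
move: ltnu; rewrite -/(value N.+1 a); lra.
Qed.

(** The horizon disappears because [edl] is the limit of the works, each of which is bounded by a
    value. *)
Lemma SAST_value_bounded :
  (forall a, exists r, forall N, value N a <= r) -> SAST step.
Proof.
move=> bnd a; have [r ler] := bnd a.
apply: (@le_lt_trans _ _ r%:E); last exact: ltry.
apply: ge_ereal_sup => _ [S seqS <-]; apply: (edl_le seqS) => N.
have [S0 liftS] := seqS.
by apply: le_trans (work_le_value N liftS) _; rewrite S0 expect_dirac.
Qed.

End Value.

(** * Sequences that follow a loop and continue elsewhere after leaving it *)

Section PumpedSequence.
Context {R : realType} {A : choiceType} (step : A -> multidist R A -> Prop).
Context (step_fdist : forall a nu, step a nu -> is_fdist nu).
Context (n : nat) (p : 'I_n -> R) (u : nat -> A) (succ : nat -> 'I_n -> A).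
Context (i0 i1 : 'I_n).
Hypotheses (p01 : forall i, 0 < p i <= 1) (p1 : \sum_(i < n) p i = 1).
Hypotheses (u_step : forall k,
  step (u k) (convex_union p (fun i => dirac_fdist (succ k i)))).
Hypotheses (succ_i0 : forall k, succ k i0 = u k.+1) (i10 : i1 != i0).

(* Follows the loop [u k -> u k.+1 -> ...] forever, and switches to the
   sequence [S k i] when the loop is left at stage [k] through branch [i]. *)
Fixpoint pumped (S : nat -> 'I_n -> nat -> multidist R A) (k m : nat) :
    multidist R A :=
  if m is m'.+1 then
    convex_union p (fun i => if i == i0 then pumped S k.+1 m' else S k i m')
  else dirac_fdist (u k).

Context (S : nat -> 'I_n -> nat -> multidist R A).
Hypothesis seqS : forall k i, lifting_seqs step (succ k i) (S k i).

Lemma pumped_lifting_seq k : lifting_seqs step (u k) (pumped S k).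
Proof.
split=> // m; elim: m k => [|m IH] k.
  suff -> : pumped S k 1 = convex_union p (fun i => dirac_fdist (succ k i)).
    exact: lifting_step.
  congr (convex_union _ _); apply: funext => i; case: eqP => [->|_].
    by rewrite succ_i0.
  by have [] := seqS k i.
apply: lifting_union => // i; case: eqP => // _.
by have [_] := seqS k i.
Qed.

(** After the first step is split off, its own contribution 1 and the branches other than [i0] and
    [i1] are nonnegative and dropped. *)
Lemma work_pumped N k :
  p i0 * work step N (pumped S k.+1) + p i1 * work step N (S k i1) <=
  work step N.+1 (pumped S k).
Proof.
have [q0 q1] : 0 <= p i0 /\ 0 <= p i1.
  by split; [case/andP: (p01 i0)|case/andP: (p01 i1)] => /ltW.
rewrite [leRHS]/work big_ord_recl /= expect_dirac.
rewrite (reducible_step (u_step k)).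
have -> : \sum_(j < N) expect (reducible step) (pumped S k (lift ord0 j)) =
    \sum_(i < n) p i * (if i == i0 then work step N (pumped S k.+1)
                        else work step N (S k i)).
  under eq_bigr do rewrite /= expect_convex_union.
  rewrite exchange_big; apply: eq_bigr => i _; rewrite -mulr_sumr.
  by case: eqP.
rewrite (bigD1 i0) //= eqxx (bigD1 i1) //= (negPf i10).
rewrite [X in 1 + X]addrA addrCA lerDl.
rewrite addr_ge0 // sumr_ge0 // => i /andP[/negPf-> _].
rewrite mulr_ge0 //; first by case/andP: (p01 i) => /ltW.
exact: work_ge0 (seqS k i).
Qed.

(** From stage 0, stage [k] is reached with probability [p i0 ^+ k], hence the unit [p i0 ^- k].
    Leaving at stage [k] yields one unit; the other [m] come from stage [k.+1], where the factor
    [p i0] cancels one power. The induction on [m] thus needs all [k]. *)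
Lemma work_pumped_unbounded :
  (forall k, exists N, p i0 ^- k <= p i1 * work step N (S k i1)) ->
  forall m k, exists N, m%:R * p i0 ^- k <= work step N (pumped S k).
Proof.
have [q0 q1] : 0 < p i0 /\ 0 < p i1.
  by split; [case/andP: (p01 i0)|case/andP: (p01 i1)].
move=> big; elim=> [|m IH] k.
  by exists 0%N; rewrite mul0r /work big_ord0.
have [[M leM] [N leN]] := (IH k.+1, big k).
exists (maxn M N).+1; apply: le_trans (work_pumped _ _).
rewrite -natr1 mulrDl mul1r; apply: lerD.
  rewrite -(@ler_pM2l _ (p i0)^-1) ?invr_gt0 // mulKf ?gt_eqF //.
  rewrite mulrCA -invfM -exprS.
  rewrite (le_trans leM) //.
  by apply: leq_work (leq_maxl _ _) (pumped_lifting_seq _).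
rewrite (le_trans leN) // ler_pM2l //.
exact: leq_work (leq_maxr _ _) (seqS _ _).
Qed.

End PumpedSequence.

(** Separates the pumping from the structure of terms: near-optimal sequences are spliced in at the
    exits through [i1]. *)
Lemma loop_not_PAST (R : realType) (A : choiceType)
    (step : A -> multidist R A -> Prop) (n : nat) (p : 'I_n -> R)
    (u : nat -> A) (succ : nat -> 'I_n -> A) (i0 i1 : 'I_n) :
  (forall a nu, step a nu -> is_fdist nu) ->
  (forall i, 0 < p i <= 1) -> \sum_(i < n) p i = 1 ->
  (forall k, step (u k) (convex_union p (fun i => dirac_fdist (succ k i)))) ->
  (forall k, succ k i0 = u k.+1) -> i1 != i0 ->
  (forall k r, exists N, r < value step N (succ k i1)) ->
  ~ PAST step.
Proof.
move=> step_fdist p01 p1 u_step succ_i0 i10 unbounded past.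
have q1 : 0 < p i1 by case/andP: (p01 i1).
(* Only the exits through [i1] must do much work; the other branches take any sequence. *)
have /choice[S SP] : forall ki : nat * 'I_n, exists S,
    lifting_seqs step (succ ki.1 ki.2) S /\
    (ki.2 = i1 -> exists N, p i0 ^- ki.1 <= p i1 * work step N S).
  move=> [k i] /=; have [->|/eqP ii1] := eqVneq i i1; last first.
    by have [S ?] := lifting_seqs_nonempty step_fdist (succ k i); exists S.
  (* The factor [(p i1)^-1] offsets the probability of the exit, and the summand 1 the loss of the
     near-optimal sequence. *)
  have [N ltN] := unbounded k ((p i1)^-1 * p i0 ^- k + 1).
  have [S seqS leS] := near_optimal_seq step_fdist N (succ k i1) ltr01.
  exists S; split=> // _; exists N.
  rewrite -(@ler_pM2l _ (p i1)^-1) ?invr_gt0 // mulKf ?gt_eqF //.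
  by apply: le_trans leS; rewrite lerBrDr ltW.
pose T k i := S (k, i).
have seqT k i : lifting_seqs step (succ k i) (T k i) by have [] := SP (k, i).
have seq_pumped := pumped_lifting_seq p01 p1 u_step succ_i0 seqT.
have /(work_pumped_unbounded step_fdist p01 p1 u_step succ_i0 i10 seqT) unb :
    forall k, exists N, p i0 ^- k <= p i1 * work step N (T k i1).
  by move=> k; have [_ /(_ erefl)] := SP (k, i1).
have := past _ _ (seq_pumped 0%N).
have leE N := work_le_edl step_fdist N (seq_pumped 0%N).
(* The value [+oo] contradicts [past], and [-oo] cannot bound a work from above; a real [r]
   remains. *)
case: (edl _ _) leE => [r leE _|//|/(_ 0%N) //].
have [N] := unb (Num.bound `|r|) 0%N.
rewrite expr0 invr1 mulr1 leNgt => /negP; apply.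
apply: le_lt_trans (le_lt_trans (ler_norm r) (archi_boundP (normr_ge0 r))).
by have := leE N; rewrite lee_fin.
Qed.

(** * Rewriting under contexts and substitutions *)

Section Rewriting.
Context {R : realType} {F : countType} {ar : F -> nat} {V : countType}.
Local Notation T := (term ar V).
Implicit Types (t u : T) (C D : context ar V) (tau sigma : substitution ar V).

Fixpoint subst_context tau C : context ar V :=
  if C is CApp f i args C' then
    CApp i (fun j => subst tau (args j)) (subst_context tau C')
  else Hole.

Lemma subst_fill tau C t :
  subst tau (fill C t) = fill (subst_context tau C) (subst tau t).
Proof.
elim: C => //= f i args C IH; congr App; apply: funext => j.
by case: eqP.
Qed.

Lemma subst_subst tau sigma t :
  subst tau (subst sigma t) = subst (fun y => subst tau (sigma y)) t.
Proof. by elim: t => //= f args IH; congr App; apply: funext => j. Qed.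

(** One occurrence of [y] becomes the hole; the others are instantiated inside [D]. *)
Lemma fill_subst_var tau y t : vars t y ->
  exists D, subst tau t = fill D (tau y).
Proof.
elim: t => /= [z ->|f args IH [i _ /IH[D DE]]]; first by exists Hole.
exists (CApp i (fun j => subst tau (args j)) D) => /=; congr App.
by apply: funext => j; case: eqP => // ->.
Qed.

Lemma rewrite_step_fill (P : set (T * multidist R T)) C t nu :
  rewrite_step P t nu -> rewrite_step P (fill C t) (map_fdist (fill C) nu).
Proof.
elim: C nu => [|f i args C IH] nu tnu /=.
  rewrite (_ : map_fdist _ _ = nu) // -[RHS]seq_mset_id; congr seq_mset.
  by rewrite -[RHS]map_id; apply: eq_map => -[].
have [pi [l [mu [sigma [Pl sub E]]]]] := IH _ tnu.
exists (nat_of_ord i :: pi), l, mu, sigma; split=> //=.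
  by rewrite insubT //= => lti; rewrite (_ : Sub _ _ = i) ?eqxx //;
    exact: val_inj.
(* Isolating the outermost layer as [g] makes the map a composition to which the induction
   hypothesis applies. *)
pose g t' := App (fun j => if j == i then t' else args j).
rewrite -[LHS]/(map_fdist (g \o fill C) nu) -map_fdist_comp E map_fdist_comp.
congr seq_mset; apply: eq_map => -[q r] /=; congr (_, App _).
by apply: funext => j; rewrite (inj_eq val_inj); case: eqP => // ->.
Qed.

(** Every step of [t] can be imitated in the hole; a normal form has value 0, whatever redexes the
    context creates. *)
Lemma value_fill (P : set (T * multidist R T)) N C t : is_ptrs P ->
  value (rewrite_step P) N t <= value (rewrite_step P) N (fill C t).
Proof.
move=> ptrsP; have stepf t' nu := @rewrite_step_fdist _ _ _ _ P t' nu ptrsP.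
elim: N t => [|N IH] t //.
case: (pselect (normal_form (rewrite_step P) t)) => [nft|/contrapT[nu0 tnu0]].
  by rewrite value_nf // value_ge0.
apply: ge_sup => [|_ [nu tnu <-]].
  by exists (1 + expect (value (rewrite_step P) N) nu0), nu0.
apply: le_trans (value_step stepf N (rewrite_step_fill C tnu)).
rewrite lerD2l expect_map_fdist; apply: le_expect => //; exact: stepf tnu.
Qed.

(** [D 0] is outermost: going from [k] to [k.+1] inserts [D k] directly around the argument, as a
    round of the loop does. *)
Fixpoint nest (D : nat -> context ar V) k t :=
  if k is k'.+1 then nest D k' (fill (D k') t) else t.

Lemma rewrite_step_nest (P : set (T * multidist R T))
    (D : nat -> context ar V) k t nu :
  rewrite_step P t nu -> rewrite_step P (nest D k t) (map_fdist (nest D k) nu).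
Proof.
elim: k t nu => [|k IH] t nu tnu /=; first exact: (rewrite_step_fill Hole).
by rewrite -[map_fdist _ _](map_fdist_comp (nest D k) (fill (D k)));
  exact/IH/rewrite_step_fill.
Qed.

Lemma value_nest (P : set (T * multidist R T)) N
    (D : nat -> context ar V) k t : is_ptrs P ->
  value (rewrite_step P) N t <= value (rewrite_step P) N (nest D k t).
Proof.
move=> ptrsP; elim: k t => [|k IH] t //=.
exact: le_trans (value_fill N (D k) t ptrsP) (IH _).
Qed.

End Rewriting.

Theorem theorem3p22 (R : realType) (F V : countType) (ar : F -> nat)
    (P : set (term ar V * multidist R (term ar V)))
    (l : term ar V) (mu : multidist R (term ar V))
    (p1 p2 : R) (C : context ar V) (sigma : substitution ar V) (s : term ar V)
    (x : V) :
  is_ptrs P ->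
  P (l, mu) ->
  ([mset (p1, fill C (subst sigma l)); (p2, s)] `<=` mu)%mset ->
  x \in vars l ->
  x \in vars (sigma x) `&` vars s ->
  PAST (rewrite_step P) <-> SAST (rewrite_step P).
Proof.
move=> ptrsP Pl sub_mu _ /set_mem[xsx xs].
have stepf t nu := @rewrite_step_fdist _ _ _ _ P t nu ptrsP.
split=> [past|sast t S seqS]; last first.
  apply: le_lt_trans (sast t); apply: ereal_sup_ubound.
  by exists S.
apply: (SAST_value_bounded stepf) => t; apply: contrapT => unbounded_t.
(* Listing the two distinguished entries first gives them distinct indices, even if the entries are
   equal. *)
pose r := enum_mset (mu `\` [mset (p1, fill C (subst sigma l)); (p2, s)])%mset.
pose b := [:: (p1, fill C (subst sigma l)), (p2, s) & r].
have muE : mu = seq_mset b.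
  by rewrite -[LHS](msetBDKC sub_mu) !mset_cons seq_mset_id msetDA.
have [_ fmu _] := ptrsP.2 _ _ Pl; rewrite muE in fmu.
have [q01 q1] := is_fdist_seq_mset fmu.
(* [tau 0] sends every variable to [t], and [tau k.+1] is [sigma] followed by [tau k]. Hence [tau k]
   turns the loop entry into the next instance of [l] inside [D k]. *)
pose tau k : substitution ar V :=
  iter k (fun tau y => subst tau (sigma y)) (fun=> t).
pose D k := subst_context (tau k) C.
pose u k := nest D k (subst (tau k) l).
pose succ k (i : 'I_(size b)) :=
  nest D k (subst (tau k) (tnth (in_tuple b) i).2).
pose i1 : 'I_(size b) := lift ord0 ord0.
apply: (@loop_not_PAST _ _ _ _ _ u succ ord0 i1 stepf q01 q1) past => //.
- move=> k; rewrite (convex_union_dirac (nest D k \o subst (tau k))).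
  rewrite -map_fdist_comp.
  (* The rule is applied at the root of the instance of [l], below the [k] accumulated contexts. *)
  apply: rewrite_step_nest; exists [::], l, mu, (tau k); split=> //.
  by rewrite -muE.
- by move=> k; rewrite /succ /u /= subst_fill subst_subst.
- move=> k c.
  have [N ltN] : exists N, c < value (rewrite_step P) N t.
    apply: contrapT => bounded; apply: unbounded_t; exists c => N.
    by rewrite leNgt; apply/negP => ltN; apply: bounded; exists N.
  exists N; apply: lt_le_trans ltN _.
  apply: le_trans (value_nest N D k _ ptrsP).
  have [E /= ->] := fill_subst_var (tau k) xs.
  apply: le_trans (value_fill N E _ ptrsP).
  (* Since [x] occurs in [sigma x], the term [tau k.+1 x] contains [tau k x]; so [t] survives every
     round. *)
  elim: k => [|k IH] //=.
  have [E' ->] := fill_subst_var (tau k) xsx.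
  exact: le_trans IH (value_fill N E' _ ptrsP).
Qed.
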